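(* Let $X$ be an infinite normal Hausdorff topological space and let $H=\mathrm{C}_p^{*}(X)$. Let $(\Phi,\tilde\Phi^{\uparrow})$ be one of $(\mathcal O,\mathcal P^{\uparrow})$, $(\Gamma,\mathcal S^{\uparrow})$. Then the following are equivalent: (a) $H$ satisfies the selection principle $\mathrm S_1(\tilde\Phi^{\uparrow}(H),\mathcal P(H))$. (b) $X$ has the covering property $\mathrm S_1(\Phi^{sh}(X),\mathcal O(X))$. (c) $H$ satisfies the selection principle $\mathrm S_1(\Phi_{\mathbf 0}(H),\mathcal O_{\mathbf 0}(H))$. (d) $H$ satisfies the selection principle $\mathrm S_1(\tilde\Phi^{\uparrow}(H),\mathcal O_{\mathbf 0}(H))$. If $X$ has the property $(\varepsilon)$, then (a)–(d) are equivalent also for $(\Phi,\tilde\Phi^{\uparrow})=(\Omega,\mathcal D^{\uparrow})$.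
   Context: The set ${}^X\mathbb R$ of all real functions on $X$ carries the product topology (pointwise convergence). $\mathrm{C}_p^{*}(X)$ is the subspace of all bounded continuous functions $X\to\mathbb R$. $\mathbf 0$ is the constant zero function on $X$. Covers: an $o$-cover is just a cover. An $\omega$-cover of $X$ is a cover $\mathcal U$ with $X\notin\mathcal U$ such that every finite $F\subseteq X$ is contained in some $U\in\mathcal U$. A $\gamma$-cover is an infinite cover $\mathcal U$ such that for every $x\in X$ the set $\{U\in\mathcal U:x\notin U\}$ is finite. $\mathcal O(X)$ is the family of all open covers. For $\varphi\in\{o,\omega,\gamma\}$ a $\varphi$-cover $\mathcal U$ is shrinkable if there is an open $\varphi$-cover $\mathcal W$ such that for every $W\in\mathcal W$ there is $U\in\mathcal U$ with $\overline W\subseteq U$. $\mathcal O^{sh}(X)$, $\Omega^{sh}(X)$, $\Gamma^{sh}(X)$ are the families of all open shrinkable $o$-, $\omega$-, $\gamma$-covers respectively. $X$ has property $(\varepsilon)$ if every open $\omega$-cover of $X$ contains a countable $\omega$-subcover. $\mathrm S_1(\mathcal A,\mathcal B)$, for families $\mathcal A,\mathcal B$ of subsets of a set: for every sequence $\langle A_n:n\in\omega\rangle$ of elements of $\mathcal A$ there are $a_n\in A_n$ ($n\in\omega$) with $\{a_n:n\in\omega\}\in\mathcal B$. For $h\in{}^X\mathbb R$ and a family $F$ of real functions on $X$: $F$ has property $(\mathcal O_h)$ if $h(x)\in\overline{\{f(x):f\in F\}}$ for every $x\in X$; $(\Omega_h)$ if $h\notin F$ and $h\in\overline F$ in ${}^X\mathbb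 R$; $(\Gamma_h)$ if $F$ is infinite and for every $\varepsilon>0$ and $x\in X$ the set $\{f\in F:|f(x)-h(x)|\ge\varepsilon\}$ is finite. For $H\subseteq{}^X\mathbb R$, $\Phi_h(H)$ is the set of all $F\subseteq H$ having property $(\Phi_h)$ and such that $f\ge h$ and $f-h\in H$ for every $f\in F$. For $F\subseteq H\subseteq{}^X\mathbb R$: $\mathcal P^{\uparrow}(H)=\mathcal P(H)$ is the set of all $F\subseteq H$ that are pointwise dense in $\mathbb R$, i.e. $\overline{\{f(x):f\in F\}}=\mathbb R$ for each $x\in X$. $F$ is upper sequentially dense in $H$ if for every $f\in H$ there is a sequence $\langle h_n:n\in\omega\rangle$ of elements of $F$ with $h_n\to f$ pointwise, $h_n\ge f$ and $h_n-f\in H$ for all $n$. $F$ is upper dense in $H$ if for every $f\in H$ the set $\{h\in F:h\ge f\wedge h-f\in H\}$ is dense in $\{h\in H:h\ge f\}$. $\mathcal S^{\uparrow}(H)$, $\mathcal D^{\uparrow}(H)$ are the sets of all upper sequentially dense, resp. upper dense, subsets of $H$.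
   Formalization: In (d) for the pair (O, P↑), the target O_0(H) is taken without the condition that f ≥ 0 and f − 0 ∈ H for its members; with that condition (d) always fails (take all f in H with some negative value), while (b) holds for X = ω discrete. *)

(* Defs.v *)
From HB Require Import structures.
From mathcomp Require Import all_boot all_order all_algebra.
From mathcomp Require Import all_classical all_reals all_analysis.

Set Implicit Arguments.
Unset Strict Implicit.
Unset Printing Implicit Defensive.

Import Order.TTheory GRing.Theory Num.Theory.
Import numFieldNormedType.Exports.

Local Open Scope classical_set_scope.
Local Open Scope ring_scope.

Definition S1 (T : Type) (A B : set (set T)) : Prop :=
  forall A_ : nat -> set T, (forall n, A (A_ n)) ->
    exists a : nat -> T, (forall n, A_ n (a n)) /\ B (range a).

(* The three values of the letter phi (resp. Phi): o, omega, gamma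
   (resp. O, Omega, Gamma). *)
Inductive kind := kO | kOmega | kGamma.

Section Covers.
Variable X : topologicalType.
Implicit Types (U W : set (set X)) (phi : kind).

Definition is_cover U : Prop := \bigcup_(A in U) A = setT.

Definition phi_cover phi U : Prop :=
  match phi with
  | kO => is_cover U
  | kOmega => [/\ is_cover U, ~ U setT &
      forall F : set X, finite_set F -> exists2 A, U A & F `<=` A]
  | kGamma => [/\ is_cover U, infinite_set U &
      forall x : X, finite_set [set A | U A /\ ~ A x]]
  end.

Definition open_phi_cover phi U : Prop := U `<=` open /\ phi_cover phi U.

Definition shrinkable phi U : Prop :=
  exists W, open_phi_cover phi W /\
    forall A, W A -> exists2 B, U B & closure A `<=` B.

Definition open_covers : set (set (set X)) := [set U | open_phi_cover kO U].

Definition open_shrinkable_covers phi : set (set (set X)) :=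
  [set U | open_phi_cover phi U /\ shrinkable phi U].

Definition property_eps : Prop :=
  forall U, open_phi_cover kOmega U ->
    exists V, [/\ V `<=` U, countable V & phi_cover kOmega V].

End Covers.

Section FunctionFamilies.
Variables (R : realType) (X : topologicalType).
Implicit Types (F H : set (X -> R)) (f g h : X -> R) (phi : kind).

Definition Cp_bounded : set (X -> R) :=
  [set f | continuous f /\ bounded_fun f].

Definition values_at F (x : X) : set R := [set f x | f in F].

Definition has_Phi phi h F : Prop :=
  match phi with
  | kO => forall x, closure (values_at F x) (h x)
  | kOmega => ~ F h /\ closure (F : set {ptws X -> R}) h
  | kGamma => infinite_set F /\
      forall (e : R) (x : X), 0 < e ->
        finite_set [set f | F f /\ e <= `|f x - h x|]
  end.

(* [upper H f h] : h >= f and h - f in H *)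
Definition upper H f h : Prop :=
  (forall x, f x <= h x) /\ H (fun x => h x - f x).

Definition Phi phi h H : set (set (X -> R)) :=
  [set F | [/\ F `<=` H, has_Phi phi h F & forall f, F f -> upper H h f]].

(* Same as [Phi] without the condition f >= h, f - h in H on the members.
   It is the target of the last principle of the (O, P) case: P(H) does not
   restrict the sign of its members, e.g. if every point of X is separated
   from another one by H, the functions of H that take a negative value form
   a pointwise dense family, and no selection from it lies in [Phi kO 0 H]. *)
Definition Phi_unsigned phi h H : set (set (X -> R)) :=
  [set F | F `<=` H /\ has_Phi phi h F].

(* Both P(H) and its "upper" version, which coincide. *)
Definition pointwise_dense H : set (set (X -> R)) :=
  [set F | F `<=` H /\ forall x, closure (values_at F x) = setT].

Definition upper_seq_dense H : set (set (X -> R)) :=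
  [set F | F `<=` H /\ forall f, H f ->
    exists h_ : nat -> X -> R,
      [/\ forall n, F (h_ n),
          forall x, h_ n x @[n --> \oo] --> f x &
          forall n, upper H f (h_ n)]].

Definition upper_dense H : set (set (X -> R)) :=
  [set F | F `<=` H /\ forall f, H f ->
    [set h | H h /\ forall x, f x <= h x] `<=`
      closure ([set h | F h /\ upper H f h] : set {ptws X -> R})].

End FunctionFamilies.

Arguments Cp_bounded : clear implicits.

(* Main.v *)
(* (a) => (b): the bounded continuous functions that are at least 1 off some
   member of a shrinkable cover [U] form an upward dense family, since a
   Urysohn function vanishing on the shrunken set and equal to 1 off the member
   can be added to any function with a large enough factor. In a pointwise
   dense selection every point has some value below 1, so it lies in the chosen
   member.
   (b) => (c): the sets [f < e] for [f] in [F] form a shrinkable cover, the sets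
   [f < e / 2] being a shrinking of it; it is of the right kind unless some
   [f < e] is all of X, and then that [f] alone serves [e]. A selection is run
   along infinitely many disjoint sequences of indices, one for each e = 1/m.
   (c) => (d): the nonnegative members of an upward dense family contain a
   family with property (Phi_0), unless the family contains 0; for Phi = O, one
   selects among absolute values instead.
   (d) => (a): upward density is invariant under adding constants, so one can
   select families approximating each rational constant. *)
Require Import Defs.
From HB Require Import structures.
From mathcomp Require Import all_boot all_order all_algebra.
From mathcomp Require Import all_classical all_reals all_analysis.
From mathcomp Require Import ring lra.

Set Implicit Arguments.
Unset Strict Implicit.
Unset Printing Implicit Defensive.

Import Order.TTheory GRing.Theory Num.Theory.
Import numFieldNormedType.Exports.
Local Open Scope classical_set_scope.
Local Open Scope ring_scope.

(** * Merging countably many selections; finite and cofinite sets *)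

(** Injectivity of [pickle] on pairs makes the sequences [k |-> pickle (i, k)] disjoint for distinct
    [i], so the selections made along them fit into one. Indices that code no pair receive a default
    element of [A_ n], obtained from the hypothesis at [i0]. *)
Lemma countable_diagonal (I : countType) (i0 : I) (T X : Type)
    (A_ : nat -> set T) (Q : I -> X -> T -> Prop) :
    (forall i (e : nat -> nat), exists b : nat -> T,
      (forall k, A_ (e k) (b k)) /\ forall x, exists k, Q i x (b k)) ->
  exists a : nat -> T,
    (forall n, A_ n (a n)) /\ forall i x, exists n, Q i x (a n).
Proof.
move=> sel.
have [b bP] := choice (fun i => sel i (fun k => pickle (i, k))).
have [c cP] : {c : nat -> T & forall n, A_ n (c n)}.
  apply: choice => n; have [c [cA _]] := sel i0 (fun=> n).
  by exists (c 0%N); apply: cA.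
pose a n := if pickle_inv n is Some (i, k) then b i k else c n.
exists a; split=> [n|i x].
  rewrite /a; have := @pickle_invK (I * nat)%type n.
  by case: pickle_inv => [[i k] /= <-|_]; [apply: (bP i).1|apply: cP].
have [k kQ] := (bP i).2 x.
by exists (pickle (i, k)); rewrite /a pickleK_inv.
Qed.

Lemma subset_S1 (T : Type) (A A' B B' : set (set T)) :
  A' `<=` A -> B `<=` B' -> S1 A B -> S1 A' B'.
Proof.
move=> AA BB sel A_ A_P; have [n|a [aP aB]] := sel A_; first exact/AA/A_P.
by exists a; split=> //; apply: BB.
Qed.

Lemma infinite_set_inj (T : Type) (A : set T) : infinite_set A ->
  exists2 s : nat -> T, injective s & forall n, A (s n).
Proof.
elim/Ppointed: T => T in A *; first by rewrite emptyE => /(_ (finite_set0 _)).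
move=> /infiniteP/ppcard_leP/unsquash f; exists f => [m n|n]; last exact: 'funS_f.
by apply: 'inj_f; rewrite in_setT.
Qed.

Lemma finite_bigcapI (I : choiceType) (T : Type) (F : set_system T)
    (D : set I) (f : I -> set T) : Filter F -> finite_set D ->
  (forall i, D i -> F (f i)) -> F (\bigcap_(i in D) f i).
Proof.
move=> FF /finite_fsetP[E ->] Ff; apply: filter_bigI => i iE; exact: Ff.
Qed.

Lemma finite_set_eventually (A : set nat) :
  finite_set A <-> \forall n \near \oo, ~ A n.
Proof.
split=> [finA|[N _ NA]].
  have gtA m : A m -> \forall n \near \oo, (m < n)%N by move=> _; exact: nbhs_infty_gt.
  have := finite_bigcapI eventually_filter finA gtA; apply: filterS => n nA An.
  by have := nA _ An; rewrite /= ltnn.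
apply: sub_finite_set (finite_II N) => n An /=.
by rewrite ltnNge; apply/negP => /NA.
Qed.

(** * Closures in the reals and in the product topology, in terms of epsilon *)

Section PointwiseClosure.
Variables (R : realType) (X : topologicalType).
Implicit Types (F : set (X -> R)) (f g h : X -> R) (x : X) (e r : R).

Lemma closure_normP (S : set R) r :
  closure S r <-> forall e, 0 < e -> exists2 y, S y & `|y - r| < e.
Proof.
split=> [clS e e0|clS B /nbhs_ballP[e /= e0 eB]].
  have [y [Sy ye]] := clS _ (nbhsx_ballx r e e0).
  by exists y => //; rewrite distrC.
have [y Sy ye] := clS e e0; exists y; split=> //.
by apply: eB; rewrite /ball /= distrC.
Qed.

Lemma values_closureP F x r :
  closure (values_at F x) r <->
  forall e, 0 < e -> exists2 f, F f & `|f x - r| < e.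
Proof.
rewrite closure_normP; split=> clF e /clF.
  by case=> _ [f Ff <-] ?; exists f.
by case=> f Ff ?; exists (f x) => //; exists f.
Qed.

Lemma ptws_closureP F h :
  closure (F : set {ptws X -> R}) h <->
  forall (S : set X) e, finite_set S -> 0 < e ->
    exists2 g, F g & forall x, S x -> `|g x - h x| < e.
Proof.
split=> [clF S e finS e0|clF].
  have cv x : \forall g \near nbhs (h : {ptws X -> R}), `|h x - g x| < e.
    have cvh : {ptws, nbhs (h : {ptws X -> R}) --> h} by apply: cvg_id.
    have cvx := (pointwise_cvgP h (nbhs_filter _)).1 cvh x.
    exact: (cvgrPdist_lt _ _).1 cvx e e0.
  have /clF[g [Fg gS]] := finite_bigcapI (nbhs_filter _) finS (fun x _ => cv x).
  by exists g => // x /gS; rewrite distrC.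
rewrite closureEcvg /=.
(* The sets of members of [F] that are [e]-close to [h] on a finite [S] form the base of a filter.
   It is proper by hypothesis, contains [F] and converges pointwise to [h]. *)
pose D := [set p : set X * R | finite_set p.1 /\ 0 < p.2].
pose B (p : set X * R) := [set g | F g /\ forall x, p.1 x -> `|g x - h x| < p.2].
have PB : ProperFilter (filter_from D B : set_system {ptws X -> R}).
  apply: filter_from_proper.
    apply: filter_from_filter; first by exists (set0, 1); split.
    move=> [S e] [S' e'] [/= finS e0] [/= finS' e'0].
    exists (S `|` S', Num.min e e').
      by split=> /=; [rewrite finite_setU|rewrite lt_min e0].
    move=> g [Fg gP]; split; split=> // x /= Sx.
      by have := gP x (or_introl Sx); rewrite lt_min => /andP[].
    by have := gP x (or_intror Sx); rewrite lt_min => /andP[].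
  by move=> [S e] [/= finS e0]; have [g Fg gS] := clF S e finS e0; exists g.
exists (filter_from D B) => //; split.
  apply: (pointwise_cvgP h PB).2 => x; apply/cvgrPdist_lt => e e0.
  exists ([set x], e); first by split=> //; apply: finite_set1.
  by move=> g [_ /(_ x erefl)] /=; rewrite distrC.
move=> G FG; exists (set0, 1); first by split.
by move=> g [Fg _]; apply: FG.
Qed.

End PointwiseClosure.

(** * Algebra of bounded continuous functions and Urysohn bumps *)

Section BoundedContinuous.
Variables (R : realType) (X : topologicalType).
Implicit Types (f g : X -> R).

Lemma Cp_boundedP f :
  Cp_bounded R X f <-> continuous f /\ exists M : R, forall x, `|f x| <= M.
Proof.
split=> -[cf]; split=> //.
  (* [bounded_fun] guarantees only the bounds strictly above [M]. *)
  by case: b => M [_ fM]; exists (M + 1) => x; apply: fM => //; rewrite ltrDl.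
case: b => M fM; exists M; split; first exact: num_real.
by move=> r Mr x _; apply: le_trans (fM x) (ltW Mr).
Qed.

Lemma Cp_cst (c : R) : Cp_bounded R X (cst c).
Proof.
apply/Cp_boundedP; split; first by move=> x; apply: cvg_cst.
by exists `|c|.
Qed.

Lemma Cp_add f g : Cp_bounded R X f -> Cp_bounded R X g ->
  Cp_bounded R X (fun x => f x + g x).
Proof.
move=> /Cp_boundedP[cf [M fM]] /Cp_boundedP[cg [N gN]].
apply/Cp_boundedP; split; first by move=> x; apply: cvgD; [apply: cf|apply: cg].
by exists (M + N) => x; apply: le_trans (ler_normD _ _) (lerD _ _).
Qed.

Lemma Cp_mul f g : Cp_bounded R X f -> Cp_bounded R X g ->
  Cp_bounded R X (fun x => f x * g x).
Proof.
move=> /Cp_boundedP[cf [M fM]] /Cp_boundedP[cg [N gN]].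
apply/Cp_boundedP; split; first by move=> x; apply: cvgM; [apply: cf|apply: cg].
by exists (M * N) => x; rewrite normrM ler_pM.
Qed.

Lemma Cp_opp f : Cp_bounded R X f -> Cp_bounded R X (fun x => - f x).
Proof.
move=> /Cp_boundedP[cf [M fM]].
apply/Cp_boundedP; split; first by move=> x; apply: cvgN; apply: cf.
by exists M => x; rewrite normrN.
Qed.

Lemma Cp_sub f g : Cp_bounded R X f -> Cp_bounded R X g ->
  Cp_bounded R X (fun x => f x - g x).
Proof. by move=> Hf Hg; apply: Cp_add => //; apply: Cp_opp. Qed.

Lemma Cp_norm f : Cp_bounded R X f -> Cp_bounded R X (fun x => `|f x|).
Proof.
move=> /Cp_boundedP[cf [M fM]].
apply/Cp_boundedP; split; first by move=> x; apply: cvg_norm; apply: cf.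
by exists M => x; rewrite normr_id.
Qed.

(* The multiple of the Urysohn function absorbs the bound of [h], so that the
   sum exceeds 1 wherever the Urysohn function equals 1. *)
Lemma Cp_bump (normalX : normal_space X) h (A B : set X) : Cp_bounded R X h ->
  open A -> closure B `<=` A ->
  exists k, [/\ Cp_bounded R X k, forall x, h x <= k x,
    forall x, B x -> k x = h x & forall x, ~ A x -> 1 <= k x].
Proof.
move=> Hh oA BA; have [_ [M hM]] := (Cp_boundedP h).1 Hh.
have [|g [cg g0 g1 g01]] := @urysohn_ext_itv X R normalX (closure B) (~` A) 0 1
  (@closed_closure _ B) (open_closedC oA) _ ltr01.
  by apply/disjoints_subset; rewrite setCK.
have {}g01 x : 0 <= g x <= 1 by have := g01 (g x); rewrite /= in_itv; apply; exists x.
have Hg : Cp_bounded R X g.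
  apply/Cp_boundedP; split=> //; exists 1 => x.
  by have /andP[? ?] := g01 x; rewrite ger0_norm.
exists (fun x => h x + (1 + `|M|) * g x); split.
- exact: Cp_add Hh (Cp_mul (Cp_cst _) Hg).
- by move=> x; rewrite lerDl mulr_ge0 ?addr_ge0//; case/andP: (g01 x).
- move=> x Bx; rewrite (g0 (g x)) ?mulr0 ?addr0//.
  by exists x => //; apply: subset_closure.
- move=> x Ax; rewrite (g1 (g x)) ?mulr1; last by exists x.
  have := hM x; have := ler_norm M; rewrite ler_norml => ? /andP[? _]; lra.
Qed.

End BoundedContinuous.

(** * Families approaching zero and nonnegative selections *)

Section Selections.
Variables (R : realType) (X : topologicalType).
Implicit Types (F D : set (X -> R)) (f g h : X -> R) (x : X) (e r : R).

Local Notation H := (Cp_bounded R X).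
Local Notation zero := (cst 0 : X -> R).

(** Indexing by [phi] lets the implications be proved for several of the three cases at once. *)
Definition upward_dense (phi : kind) : set (set (X -> R)) :=
  match phi with
  | kO => pointwise_dense H
  | kOmega => upper_dense H
  | kGamma => upper_seq_dense H
  end.

(** Each of the three properties approximates [h] at single points; for [kGamma], an infinite family
    remains nonempty after removal of the finitely many members far from [h] at [x]. *)
Lemma has_Phi_near phi h F x e : has_Phi phi h F -> 0 < e ->
  exists2 f, F f & `|f x - h x| < e.
Proof.
case: phi => /= [hF|[_ hF]|[FF hF]] e0.
- exact: (values_closureP _ _ _).1 (hF x) e e0.
- have [g Fg gx] := (ptws_closureP F h).1 hF [set x] e (finite_set1 x) e0.
  by exists g => //; apply: gx.
have [f [Ff nf]] := infinite_setN0 (infinite_setD FF (hF e x e0)).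
by exists f => //; rewrite ltNge; apply/negP => fe; apply: nf.
Qed.

Lemma Phi_kO_seqP (a : nat -> X -> R) :
  (forall n, H (a n)) -> (forall n x, 0 <= a n x) ->
  Phi kO zero H (range a) <->
  forall x e, 0 < e -> exists n, a n x < e.
Proof.
move=> Ha a0; split=> [[_ aO _] x e e0|aO].
  have [_ [n _ <-]] := (values_closureP _ _ _).1 (aO x) e e0.
  by rewrite subr0 ger0_norm// => ?; exists n.
split=> [_ [n _ <-]//|x|_ [n _ <-]].
  apply/values_closureP => e e0; have [n ne] := aO x e e0.
  by exists (a n); [exists n|rewrite subr0 ger0_norm].
by split=> //; apply: Cp_sub (Ha n) (Cp_cst _ _).
Qed.

(** * From covers to families approaching zero *)

(** That every [f] reaches [e] somewhere keeps the whole space out of the cover and, for [kGamma],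
    makes the passage from [f] to its level set finite-to-one. *)
Lemma level_cover phi F e : 0 < e -> Phi phi zero H F ->
  (forall f, F f -> exists x, e <= f x) ->
  open_phi_cover phi [set [set x | f x < e] | f in F].
Proof.
move=> e0 [FH FP Fup] Fe.
have F0 f x : F f -> 0 <= f x by move=> /Fup[+ _]; apply.
have coverF : is_cover [set [set x | f x < e] | f in F].
  apply/seteqP; split=> // x _.
  have [f Ff fx] := has_Phi_near x FP e0.
  exists [set y | f y < e]; first by exists f.
  by move: fx; rewrite subr0 ger0_norm ?F0.
split=> [_ [f Ff <-]|].
  by apply: (@open_comp _ _ f [set y | y < e]) => // x _; apply: (FH f Ff).1.
have lev_neq f : F f -> [set x | f x < e] <> setT.
  move=> /Fe[x xe] levT; have : [set x | f x < e] x by rewrite levT.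
  by rewrite /= ltNge xe.
case: phi FP => //= -[]; last first.
  move=> infF finF; split=> // [finU|x].
    have : finite_set F; last exact: infF.
    (* With finitely many level sets, [F] would be a finite union of fibres. A fibre is finite, as
       its members are all at least [e] at one common point outside the level set. *)
    apply: sub_finite_set (_ : finite_set (\bigcup_(A in [set [set x | f x < e] | f in F])
       [set f | F f /\ [set x | f x < e] = A])).
      by move=> f Ff; exists [set x | f x < e] => //; exists f.
    apply: bigcup_finite => // _ [f Ff <-].
    have [x xe] := Fe f Ff.
    apply: sub_finite_set (finF e x e0) => g [Fg gf]; split=> //=.
    rewrite subr0 ger0_norm ?F0// leNgt; apply/negP => gx.
    by have : [set x | g x < e] x by []; rewrite gf /= ltNge xe.
  apply: sub_finite_set (finite_image (fun f => [set x | f x < e]) (finF e x e0)).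
  move=> _ [[f Ff <-] /negP]; rewrite -leNgt => fx; exists f => //; split=> //.
  by rewrite subr0 ger0_norm ?F0.
move=> _ /ptws_closureP clF; split=> //.
  by move=> [f Ff]; apply: lev_neq.
move=> S finS; have [f Ff fS] := clF S e finS e0.
exists [set x | f x < e]; first by exists f.
by move=> x /fS; rewrite subr0 ger0_norm ?F0.
Qed.

Lemma level_shrinkable phi F e : 0 < e -> Phi phi zero H F ->
  (forall f, F f -> exists x, e <= f x) ->
  open_shrinkable_covers phi [set [set x | f x < e] | f in F].
Proof.
move=> e0 FP Fe; split; first exact: level_cover.
exists [set [set x | f x < e / 2] | f in F]; split.
  apply: level_cover => // [|f /Fe[x xe]]; first by lra.
  by exists x; apply: le_trans xe; lra.
move=> _ [f Ff <-]; exists [set x | f x < e]; first by exists f.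
have clf : closed [set x | f x <= e / 2].
  apply: (@closed_comp _ _ f [set y | y <= e / 2]) => [x _|]; last exact: closed_le.
  by case: FP => FH _ _; apply: (FH f Ff).1.
apply: subset_trans (_ : [set x | f x <= e / 2] `<=` _); last first.
  by move=> x /= fx; apply: le_lt_trans fx _; lra.
move/closure_id: clf => ->; apply: closureS => x /=; exact: ltW.
Qed.

Lemma S1_covers_Phi phi (x0 : X) :
  S1 (open_shrinkable_covers phi) (@open_covers X) ->
  S1 (Phi phi zero H) (Phi kO zero H).
Proof.
move=> sel F_ FP.
have F0 n f : F_ n f -> forall x, 0 <= f x by have [_ _ Fup] := FP n; move/Fup => [].
have FH n f : F_ n f -> H f by have [+ _ _] := FP n; apply.
have [|a [aF aP]] := @countable_diagonal nat 0%N _ _ F_ (fun m x f => f x < m.+1%:R^-1).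
  move=> m e; have m0 : 0 < m.+1%:R^-1 :> R by rewrite invr_gt0.
  (* A member below the bound everywhere settles this [m] at its own index [k], the other indices
     being filled arbitrarily. Without such a member the level sets form shrinkable covers. *)
  have [[k [f [Ff fm]]]|nok] := pselect
    (exists k f, F_ (e k) f /\ forall x, f x < m.+1%:R^-1).
    have FN0 n : exists g, F_ (e n) g.
      have [_ FPn _] := FP (e n).
      have [g] := has_Phi_near x0 FPn ltr01.
      by exists g.
    have [b bF] := choice FN0.
    exists (fun n => if n == k then f else b n); split=> [n|x].
      by have [->|_] := eqVneq n k; [exact: Ff|exact: bF].
    by exists k; rewrite eqxx.
  have [n|A [AP [_ covA]]] := sel (fun k =>
      [set [set x | f x < m.+1%:R^-1] | f in F_ (e k)]).
    apply: level_shrinkable => // f Ff; apply/not_existsP => fm.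
    apply: nok; exists n, f; split=> // x; rewrite ltNge; apply/negP; exact: fm.
  have fA k : exists f, F_ (e k) f /\ [set x | f x < m.+1%:R^-1] = A k.
    by have [f Ff fA] := AP k; exists f.
  have [b bP] := choice fA.
  exists b; split=> [k|x]; first exact: (bP k).1.
  have : (\bigcup_(B in range A) B) x by rewrite covA.
  by case=> _ [k _ <-]; rewrite -(bP k).2; exists k.
exists a; split=> //; apply/Phi_kO_seqP => [n|n|x e e0].
- exact: FH (aF n).
- exact: F0 (aF n).
have [m me] := ltr_add_invr e0; rewrite add0r in me.
by have [n ne] := aP m x; exists n; apply: lt_trans me.
Qed.

(** * From families approaching zero to upward dense families *)

(** Upward density is applied at the function [zero]: the members above it accumulate at it, or some
    sequence of them converges to it. For [kO] no sign is guaranteed. *)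
Lemma upward_dense_Phi phi D : phi <> kO -> upward_dense phi D -> ~ D zero ->
  exists2 F, F `<=` [set f | D f /\ upper H zero f] & Phi phi zero H F.
Proof.
move=> phiO DP D0; have Hz : H zero by exact: Cp_cst.
case: phi phiO DP => // _ [DH /(_ zero Hz)].
  move=> clD; exists [set f | D f /\ upper H zero f] => //.
  split=> [f [/DH]//||f []//]; split=> [[]//|].
  by apply: clD.
move=> [s [sD scv sup]]; exists (range s); first by move=> _ [n _ <-].
have fin_ge e x : 0 < e -> finite_set [set n | e <= `|s n x|].
  move=> e0; apply/finite_set_eventually.
  have /cvgrPdist_lt/(_ e e0) := scv x.
  by apply: filterS => n; rewrite sub0r normrN ltNge => /negP.
split=> [_ [n _ <-]|| _ [n _ <-]//]; first exact/DH/sD.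
split=> [fins|e x e0].
  (* A sequence without value 0 and with finite range takes some value [f]
     infinitely often, although [f x <> 0] at some [x]. *)
  apply: infinite_nat; apply: sub_finite_set (_ : finite_set
      (\bigcup_(f in range s) [set n | s n = f])).
    by move=> n _; exists (s n) => //; exists n.
  apply: bigcup_finite => // _ [n _ <-].
  have [x snx] : exists x, s n x <> 0.
    apply/existsNP => sn0; apply: D0.
    by have <- : s n = zero by apply/funext.
  have snx0 : 0 < `|s n x| by rewrite normr_gt0; apply/eqP.
  by apply: sub_finite_set (fin_ge _ x snx0) => m /= ->.
apply: sub_finite_set (finite_image s (fin_ge e x e0)).
by move=> _ [[n _ <-]]; rewrite subr0 => ne; exists n.
Qed.

Lemma S1_Phi_dense phi (x0 : X) : phi <> kO ->
  S1 (Phi phi zero H) (Phi kO zero H) -> S1 (upward_dense phi) (Phi kO zero H).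
Proof.
move=> phiO sel D_ DP; pose F_ n := [set f | D_ n f /\ upper H zero f].
have FH n f : F_ n f -> H f.
  move=> [_ [_]]; have -> // : (fun x => f x - zero x) = f.
  by apply/funext => x; rewrite subr0.
have F0 n f : F_ n f -> forall x, 0 <= f x by move=> [_ []].
have F_zero n : D_ n zero -> F_ n zero.
  by move=> Dn; split=> //; split=> //; apply: Cp_sub (Cp_cst _ _) (Cp_cst _ _).
(* The zero function, chosen once, already gives the target property; the other choices need only be
   nonnegative. *)
have [[k Dk]|D0] := pselect (exists k, D_ k zero).
  have FN0 n : exists f, F_ n f.
    have [/F_zero ?|Dn0] := pselect (D_ n zero); first by exists zero.
    have [G GF [_ GP _]] := upward_dense_Phi phiO (DP n) Dn0.
    by have [f /GF] := has_Phi_near x0 GP ltr01; exists f.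
  have [b bF] := choice FN0.
  pose a n := if n == k then zero else b n.
  have aF n : F_ n (a n).
    by rewrite /a; have [->|_] := eqVneq n k; [exact: F_zero|exact: bF].
  exists a; split=> [n|]; first exact: (aF n).1.
  apply/Phi_kO_seqP => [n|n|x e e0]; [exact: FH (aF n)|exact: F0 (aF n)|].
  by exists k; rewrite /a eqxx.
have GP n : exists G, G `<=` F_ n /\ Phi phi zero H G.
  have [|G GF GP] := @upward_dense_Phi phi (D_ n) phiO (DP n).
    by move=> Dn; apply: D0; exists n.
  by exists G.
have [G_ G_P] := choice GP.
have [n|a [aG aO]] := sel G_; first exact: (G_P n).2.
by exists a; split=> // n; case: ((G_P n).1 _ (aG n)).
Qed.

(** Absolute values preserve the distance to 0, so a selection among them lifts back to the original
    functions. Their signs are lost, whence the target [Phi_unsigned]. *)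
Lemma S1_Phi_pointwise_dense : S1 (Phi kO zero H) (Phi kO zero H) ->
  S1 (pointwise_dense H) (Phi_unsigned kO zero H).
Proof.
move=> sel D_ DP.
have [n|a [aD [_ aO _]]] := sel (fun n => [set (fun x => `|f x|) | f in D_ n]).
  have [DH Dd] := DP n; split.
  - by move=> _ [f /DH Hf <-]; apply: Cp_norm.
  - move=> x; apply/values_closureP => e e0.
    have clD : closure (values_at (D_ n) x) 0 by rewrite Dd.
    have [f Df fx] := (values_closureP _ _ _).1 clD e e0.
    exists (fun x => `|f x|); first by exists f.
    by move: fx; rewrite !subr0 normr_id.
  - move=> _ [f /DH Hf <-]; split=> [x|]; first exact: normr_ge0.
    exact: Cp_sub (Cp_norm Hf) (Cp_cst _ _).
have bP n : exists f, D_ n f /\ (fun x => `|f x|) = a n.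
  by have [f] := aD n; exists f.
have {bP}[b bP] := choice bP.
exists b; split=> [n|]; first exact: (bP n).1.
split=> [_ [n _ <-]|x]; first by have [DH _] := DP n; apply/DH/(bP n).1.
apply/values_closureP => e e0.
have [_ [n _ <-]] := (values_closureP _ _ _).1 (aO x) e e0.
by rewrite -(bP n).2 !subr0 normr_id => ?; exists (b n); [exists n|rewrite subr0].
Qed.

(** * From approximation of zero to pointwise density *)

Lemma upward_dense_translate phi D (c : R) : upward_dense phi D ->
  upward_dense phi [set (fun x => f x - c) | f in D].
Proof.
have Hc g : H g -> H (fun x => g x + c) by move=> Hg; apply: Cp_add Hg (Cp_cst _ _).
have HBc g : H g -> H (fun x => g x - c) by move=> Hg; apply: Cp_sub Hg (Cp_cst _ _).
have upc f h : upper H (fun x => f x + c) h -> upper H f (fun x => h x - c).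
  move=> [fh Hfh]; split=> [x|]; first by have := fh x; lra.
  by have <- : (fun x => h x - (f x + c)) = (fun x => h x - c - f x)
    by apply/funext => x; ring.
case: phi => -[DH DP]; (split; first by move=> _ [f /DH Hf <-]; apply: HBc).
- move=> x; apply/seteqP; split=> // r _; apply/values_closureP => e e0.
  have clD : closure (values_at D x) (r + c) by rewrite DP.
  have [f Df fx] := (values_closureP _ _ _).1 clD e e0.
  exists (fun x => f x - c); first by exists f.
  by have -> : f x - c - r = f x - (r + c) by ring.
- move=> f Hf h [Hh fh]; apply/ptws_closureP => S e finS e0.
  have clD := DP _ (Hc f Hf) (fun x => h x + c) (conj (Hc h Hh) _).
  have [|g [Dg fg] gh] := (ptws_closureP _ _).1 (clD _) S e finS e0.
    by move=> x; rewrite lerD2r.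
  exists (fun x => g x - c); first by split; [exists g|apply: upc].
  move=> x /gh; by have -> : g x - c - h x = g x - (h x + c) by ring.
- move=> f Hf; have [s [sD scv sup]] := DP _ (Hc f Hf).
  exists (fun n x => s n x - c); split=> [n|x|n].
  + by exists (s n).
  + have -> : f x = f x + c - c by ring.
    by apply: cvgB; [exact: scv|exact: cvg_cst].
  + exact: upc.
Qed.

Lemma S1_dense_translates phi :
  S1 (upward_dense phi) (Phi_unsigned kO zero H) ->
  S1 (upward_dense phi) (pointwise_dense H).
Proof.
move=> sel D_ DP.
(* One selection is made for each rational target [q] and each precision index [m]; translating by
   [q] turns approximation of [q] into approximation of 0. *)
have [|a [aD aP]] := @countable_diagonal (rat * nat)%type (0, 0%N) _ _ D_
    (fun qm x f => `|f x - ratr qm.1| < qm.2.+1%:R^-1).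
  move=> [q m] e /=.
  have [n|b [bD [_ bO]]] := sel (fun k => [set (fun x => f x - ratr q) | f in D_ (e k)]).
    exact: upward_dense_translate.
  have cP k : exists f, D_ (e k) f /\ (fun x => f x - ratr q) = b k.
    by have [f] := bD k; exists f.
  have {cP}[c cP] := choice cP; exists c; split=> [k|x]; first exact: (cP k).1.
  have m0 : 0 < m.+1%:R^-1 :> R by rewrite invr_gt0.
  have [_ [k _ <-]] := (values_closureP _ _ _).1 (bO x) _ m0.
  by rewrite -(cP k).2 subr0; exists k.
exists a; split=> //; split.
  move=> _ [n _ <-]; apply: (_ : D_ n `<=` H) (aD n).
  by case: phi DP {sel} => /(_ n)[].
move=> x; suff clx (r : R) : closure (values_at (range a) x) r.
  by apply/seteqP; split=> // r _; apply: clx.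
apply/values_closureP => e e0.
(* Half of [e] goes to the distance from [r] to [q], the other half to the distance from [q] to the
   selected value. *)
have [q] : exists q : rat, ratr q \in `]r, (r + e / 2)[.
  by apply: rat_in_itvoo; rewrite ltrDl divr_gt0.
rewrite in_itv /= => /andP[rq qe].
have [m] : exists m, 0 + m.+1%:R^-1 < e / 2 by apply: ltr_add_invr; rewrite divr_gt0.
rewrite add0r => me; have [n] := aP (q, m) x; rewrite /= => nq.
exists (a n); first by exists n.
move: (m.+1%:R^-1) me nq => d de.
rewrite !ltr_norml => /andP[? ?]; apply/andP; split; lra.
Qed.

(** * From upward dense families to shrinkable covers *)

Lemma shrinkable_dense phi (U : set (set X)) : normal_space X ->
  open_shrinkable_covers phi U ->
  upward_dense phi [set f | H f /\ exists2 A, U A & forall x, ~ A x -> 1 <= f x].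
Proof.
move=> normalX [[oU _] [W [[_ WP] WU]]].
have Wbump h B : H h -> W B -> exists k, [/\ H k,
    exists2 A, U A & forall x, ~ A x -> 1 <= k x,
    forall x, h x <= k x & forall x, B x -> k x = h x].
  move=> Hh /WU[A UA BA]; have [k [Hk hk kB kA]] := Cp_bump normalX Hh (oU A UA) BA.
  by exists k; split=> //; exists A.
case: phi WP => [covW|[_ _ finW]|[_ infW finW]]; (split; first by move=> f []).
(* The bump is added to the constant [r] and vanishes on a set of [W] around [x]. *)
- move=> x; apply/seteqP; split=> // r _; apply/values_closureP => e e0.
  have [B WB Bx] : (\bigcup_(B in W) B) x by rewrite covW.
  have [k [Hk kU _ kB]] := Wbump _ B (Cp_cst X r) WB.
  by exists k; [split|rewrite kB// subrr normr0].
(* The bump is added to [h] and vanishes on a set of [W] containing all of [S], so the sum agrees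
   with [h] on [S] and stays above [f]. *)
- move=> f Hf h [Hh fh]; apply/ptws_closureP => S e finS e0.
  have [B WB SB] := finW S finS; have [k [Hk kU hk kB]] := Wbump h B Hh WB.
  exists k; last by move=> x /SB Bx; rewrite kB// subrr normr0.
  split; first by split.
  by split=> [x|]; [exact: le_trans (hk x)|exact: Cp_sub].
(* Along distinct sets of [W], each [x] lies in all but finitely many, so the bumped functions are
   eventually equal to [f] at [x]. *)
- move=> f Hf; have [s sinj sW] := infinite_set_inj infW.
  have kP n := Wbump f (s n) Hf (sW n).
  have {kP}[k kP] := choice kP.
  exists k; split=> [n|x|n]; first by have [] := kP n.
    apply: cvg_near_cst.
    have : finite_set [set n | ~ s n x].
      apply: sub_finite_set (finite_preimage (in2W sinj) (finW x)).
      by move=> n /= nx; split.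
    move/finite_set_eventually; apply: filterS => n /contrapT snx.
    by have [_ _ _ ->] := kP n.
  by have [Hk _ fk _] := kP n; split=> //; apply: Cp_sub.
Qed.

Lemma S1_dense_covers phi : normal_space X ->
  S1 (upward_dense phi) (pointwise_dense H) ->
  S1 (open_shrinkable_covers phi) (@open_covers X).
Proof.
move=> normalX sel U_ UP.
have [n|a [aD [_ aP]]] := sel (fun n =>
    [set f | H f /\ exists2 A, U_ n A & forall x, ~ A x -> 1 <= f x]).
  exact: shrinkable_dense.
have AP n : exists A, U_ n A /\ forall x, ~ A x -> 1 <= a n x.
  by have [_ [A]] := aD n; exists A.
have {AP}[A AP] := choice AP.
exists A; split=> [n|]; first exact: (AP n).1.
split=> [_ [n _ <-]|]; first by have [[oU _] _] := UP n; apply/oU/(AP n).1.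
apply/seteqP; split=> // x _.
have cl0 : closure (values_at (range a) x) 0 by rewrite aP.
have [_ [n _ <-]] := (values_closureP _ _ _).1 cl0 1 ltr01.
rewrite subr0 ltr_norml => /andP[_ an1]; exists (A n); first by exists n.
by apply: contrapT => /(AP n).2; rewrite leNgt an1.
Qed.

End Selections.

Theorem theorem8p4 (R : realType) (X : topologicalType)
  (infX : infinite_set [set: X]) (normalX : normal_space X)
  (hausdorffX : hausdorff_space X) :
  let H := Cp_bounded R X in
  let zero : X -> R := cst 0 in
  [/\ [<-> S1 (pointwise_dense H) (pointwise_dense H);
           S1 (@open_shrinkable_covers X kO) (@open_covers X);
           S1 (Phi kO zero H) (Phi kO zero H);
           S1 (pointwise_dense H) (Phi_unsigned kO zero H)],
      [<-> S1 (upper_seq_dense H) (pointwise_dense H);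
           S1 (@open_shrinkable_covers X kGamma) (@open_covers X);
           S1 (Phi kGamma zero H) (Phi kO zero H);
           S1 (upper_seq_dense H) (Phi kO zero H)] &
      property_eps X ->
      [<-> S1 (upper_dense H) (pointwise_dense H);
           S1 (@open_shrinkable_covers X kOmega) (@open_covers X);
           S1 (Phi kOmega zero H) (Phi kO zero H);
           S1 (upper_dense H) (Phi kO zero H)]].
Proof.
move=> H zero; have [x0 _] := infinite_setN0 infX.
(* Dropping the sign condition lets [S1_dense_translates] close all three cycles. *)
have unsign : Phi kO zero H `<=` Phi_unsigned kO zero H by move=> F [].
split=> [||_]; tfae.
- exact: (@S1_dense_covers R X kO normalX).
- exact: S1_covers_Phi.
- exact: S1_Phi_pointwise_dense.
- exact: (@S1_dense_translates R X kO).
- exact: (@S1_dense_covers R X kGamma normalX).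
- exact: S1_covers_Phi.
- exact: (@S1_Phi_dense R X kGamma x0).
- by move=> /(subset_S1 (@subset_refl _ _) unsign)/(@S1_dense_translates R X kGamma).
- exact: (@S1_dense_covers R X kOmega normalX).
- exact: S1_covers_Phi.
- exact: (@S1_Phi_dense R X kOmega x0).
- by move=> /(subset_S1 (@subset_refl _ _) unsign)/(@S1_dense_translates R X kOmega).
Qed.
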